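(* Let $L$ be an effect algebra with the Riesz Decomposition Property, let $G$ be a normed group and let $\mu:L\to G$ be a measure. Then the variation $|\mu|:L\to[0,+\infty]$ is also a measure on $L$, i.e. $|\mu|(e\oplus f)=|\mu|(e)+|\mu|(f)$ for all orthogonal $e,f\in L$.
   Context: An effect algebra $(L,\oplus,0,1)$ is a set $L$ with elements $0,1\in L$ and a partial binary operation $\oplus$ such that for all $p,q,r\in L$: (E1) if $p\oplus q$ is defined then $q\oplus p$ is defined and equal to it; (E2) if $q\oplus r$ and $p\oplus(q\oplus r)$ are defined then $p\oplus q$ and $(p\oplus q)\oplus r$ are defined and $(p\oplus q)\oplus r=p\oplus(q\oplus r)$; (E3) for every $p$ there is a unique $q$ with $p\oplus q=1$; (E4) if $1\oplus p$ is defined then $p=0$. The partial order is: $p\le q$ iff there is $r$ with $p\oplus r=q$. Elements $p,q$ are orthogonal if $p\oplus q$ is defined. Finite orthosums are defined inductively (independent of the order). $L$ has the Riesz Decomposition Property (RDP) if $c\le a\oplus b$ implies $c=c_1\oplus c_2$ with $c_1\le a$ and $c_2\le b$. All groups are commutative and additive. A normed group is a group $G$ with a function $\|\cdot\|:G\to[0,\infty)$ with $\|g\|=0$ iff $g=0$, $\|-g\|=\|g\|$ and $\|g+f\|\le\|g\|+\|f\|$. A map $\mu:L\to G$ is a measure if $\mu(a\oplus b)=\mu(a)+\mu(b)$ for all orthogonal $a,b\in L$. A decomposition of $e\in L$ is a finite family $e_1,\dots,e_n\in L$ whose orthosum exists and satisfies $e=e_1\oplus\dots\oplus e_n$. The variation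 of $\mu$ is $|\mu|(e):=\sup\sum_{i=1}^n\|\mu(e_i)\|\in[0,+\infty]$, the supremum being over all decompositions of $e$. *)

(* Defs.v *)
From HB Require Import structures.
From mathcomp Require Import all_boot all_order all_algebra.
From mathcomp Require Import classical_sets reals ereal.

Set Implicit Arguments.
Unset Strict Implicit.
Unset Printing Implicit Defensive.

Import Order.TTheory GRing.Theory Num.Theory.
Local Open Scope classical_set_scope.
Local Open Scope ring_scope.

(* The partial operation is an option-valued function: [ea_add p q = Some r]
   reads "p (+) q is defined and equals r". *)
Record effectAlgebra := EffectAlgebra {
  ea_sort :> Type;
  ea_zero : ea_sort;
  ea_one : ea_sort;
  ea_add : ea_sort -> ea_sort -> option ea_sort;
  ea_addC : forall p q s, ea_add p q = Some s -> ea_add q p = Some s;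
  ea_addA : forall p q r qr s,
    ea_add q r = Some qr -> ea_add p qr = Some s ->
    exists pq, ea_add p q = Some pq /\ ea_add pq r = Some s;
  ea_compl : forall p, exists! q, ea_add p q = Some ea_one;
  ea_one_add : forall p s, ea_add ea_one p = Some s -> p = ea_zero
}.

Definition ea_le (L : effectAlgebra) (p q : L) : Prop :=
  exists r, ea_add p r = Some q.

Definition RDP (L : effectAlgebra) : Prop :=
  forall a b ab c : L, ea_add a b = Some ab -> ea_le c ab ->
    exists c1 c2 : L, [/\ ea_add c1 c2 = Some c, ea_le c1 a & ea_le c2 b].

(* (...((x (+) s_1) (+) s_2) ...) (+) s_k, if all the partial sums exist. *)
Fixpoint orthosum (L : effectAlgebra) (x : L) (s : seq L) : option L :=
  if s is y :: s' then
    if ea_add x y is Some z then orthosum z s' else None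
  else Some x.

(* Families are indexed by 1, ..., n with n >= 1. *)
Definition decomposition (L : effectAlgebra) (e : L) (s : seq L) : Prop :=
  if s is x :: s' then orthosum x s' = Some e else False.

(* Not the library's [normedZmodType], whose norm is moreover homogeneous
   for integer multiples. *)
Record normedGroup (R : realType) := NormedGroup {
  ng_sort :> zmodType;
  ng_norm : ng_sort -> R;
  ng_norm_ge0 : forall g, 0 <= ng_norm g;
  ng_norm_eq0 : forall g, ng_norm g = 0 <-> g = 0;
  ng_normN : forall g, ng_norm (- g) = ng_norm g;
  ng_normD : forall g f, ng_norm (g + f) <= ng_norm g + ng_norm f
}.

(* The codomain is an [nmodType] so that both groups and [\bar R] qualify. *)
Definition is_measure (L : effectAlgebra) (M : nmodType) (mu : L -> M) : Prop :=
  forall a b ab : L, ea_add a b = Some ab -> mu ab = mu a + mu b.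

Definition variation (R : realType) (L : effectAlgebra) (G : normedGroup R)
    (mu : L -> G) (e : L) : \bar R :=
  ereal_sup [set (\sum_(x <- s) ng_norm (mu x))%:E | s in decomposition e].

(* Main.v *)
Require Import Defs.
From HB Require Import structures.
From mathcomp Require Import all_boot all_order all_algebra.
From mathcomp Require Import classical_sets reals ereal.

Set Implicit Arguments.
Unset Strict Implicit.
Unset Printing Implicit Defensive.

Import Order.TTheory GRing.Theory Num.Theory.
Local Open Scope ring_scope.

(** Concatenating decompositions of [a] and [b] decomposes their sum, so the
    variation is superadditive.  Conversely, by cancellation the RDP yields
    2x2 refinements of two equal sums, and iterating them splits each member of
    a decomposition of the sum into a part below [a] and a part below [b]; the
    triangle inequality then gives subadditivity. *)

Section EffectAlgebraTheory.
Variable L : effectAlgebra.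
Implicit Types (a b c x y : L) (s t : seq L).

Lemma ea_addAr p q r pq x : ea_add p q = Some pq -> ea_add pq r = Some x ->
  exists qr : L, ea_add q r = Some qr /\ ea_add p qr = Some x.
Proof.
move=> /ea_addC qp /ea_addC rpq; have [rq [rq_def rqp]] := ea_addA qp rpq.
by exists rq; split; apply: ea_addC.
Qed.

(** If [x'] is the complement of [x], then [b] and [c] are both complements of [a] (+) [x'], and
    complements are unique. *)
Lemma ea_addI a b c x : ea_add a b = Some x -> ea_add a c = Some x -> b = c.
Proof.
move=> ab ac; have [x' [x'P _]] := ea_compl x.
have [u [bx' au]] := ea_addAr (ea_addC ab) x'P.
have [v [cx' av]] := ea_addAr (ea_addC ac) x'P.
have uv : u = v by move: cx'; rewrite bx' => -[].
subst v; have [w [_ w_uniq]] := ea_compl u.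
by rewrite -(w_uniq b (ea_addC au)) -(w_uniq c (ea_addC av)).
Qed.

Lemma RDP_refinement a b x y e : RDP L ->
  ea_add a b = Some e -> ea_add x y = Some e ->
  exists x1 x2 y1 y2 : L,
    [/\ ea_add x1 x2 = Some x, ea_add y1 y2 = Some y,
        ea_add x1 y1 = Some a & ea_add x2 y2 = Some b].
Proof.
move=> rdp ab xy.
have [x1 [x2 [x12 [y1 xy1] [y2 xy2]]]] := rdp _ _ _ _ ab (ex_intro _ y xy).
exists x1, x2, y1, y2; split=> //.
(* [y1] and [y2] are the remainders of [x1] in [a] and of [x2] in [b]. Regrouping (x1 + y1) + (x2 +
   y2) as (x1 + x2) + (y1 + y2) gives x + w = e with w = y1 + y2, and cancelling [x] yields w =
   y. *)
have [u [y1b x1u]] := ea_addAr xy1 ab.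
have [v [y1x2 vy2]] := ea_addA xy2 y1b.
have [w [y12 x2w]] := ea_addAr (ea_addC y1x2) vy2.
have [z [x1x2 zw]] := ea_addA x2w x1u.
have zx : z = x by move: x1x2; rewrite x12 => -[].
by subst z; rewrite (ea_addI xy zw).
Qed.

Lemma orthosum_cat x s t :
  orthosum x (s ++ t) = obind (fun a => orthosum a t) (orthosum x s).
Proof. by elim: s x => //= y s IHs x; case: (ea_add x y). Qed.

Lemma ea_add_orthosum a b c y t :
  orthosum y t = Some b -> ea_add a b = Some c ->
  orthosum a (y :: t) = Some c.
Proof.
elim: t y => [|w t IHt] y /=; first by move=> [->] ->.
case yw: (ea_add y w) => [v|//] vt ab.
have /= := IHt v vt ab; case av: (ea_add a v) => [z|//] zt.
(* Since a + (y + w) exists, so does the partial sum a + y, and adding [w] to it gives the same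
   value. *)
by have [ay [-> /= ->]] := ea_addA yw av.
Qed.

Lemma decomposition_cat a b c s t : ea_add a b = Some c ->
  decomposition a s -> decomposition b t -> decomposition c (s ++ t).
Proof.
case: s t => [|x s] [|y t] //= ab xs yt.
by rewrite orthosum_cat xs; apply: ea_add_orthosum yt ab.
Qed.

End EffectAlgebraTheory.

Section Variation.
Context (R : realType) (L : effectAlgebra) (G : normedGroup R) (mu : L -> G).
Hypothesis mu_measure : is_measure mu.

Lemma measure_norm_le (x1 x2 x : L) : ea_add x1 x2 = Some x ->
  ng_norm (mu x) <= ng_norm (mu x1) + ng_norm (mu x2).
Proof. by move=> /mu_measure ->; apply: ng_normD. Qed.

(** The accumulator x + y is split first, by induction; a 2x2 refinement then pulls that splitting
    back to [x] and [y]. The accumulator is a partial sum rather than a member of the family, so its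
    norm stays out of the inequality. *)
Lemma orthosum_split (a b c x : L) (s : seq L) : RDP L ->
  ea_add a b = Some c -> orthosum x s = Some c ->
  exists (x1 x2 : L) (s1 s2 : seq L),
    [/\ ea_add x1 x2 = Some x, orthosum x1 s1 = Some a,
        orthosum x2 s2 = Some b &
        \sum_(y <- s) ng_norm (mu y) <=
        \sum_(y <- s1) ng_norm (mu y) + \sum_(y <- s2) ng_norm (mu y)].
Proof.
move=> rdp ab; elim: s x => [|y s IHs] x /=.
  by move=> [->]; exists a, b, [::], [::]; rewrite !big_nil addr0; split.
case xy: (ea_add x y) => [z|//] /IHs[z1 [z2 [s1 [s2 [z12 zs1 zs2 le_s]]]]].
have [x1 [x2 [y1 [y2 [x12 y12 xy1 xy2]]]]] := RDP_refinement rdp z12 xy.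
exists x1, x2, (y1 :: s1), (y2 :: s2); rewrite /= xy1 xy2; split=> //.
by rewrite !big_cons addrACA lerD // measure_norm_le.
Qed.

Lemma decomposition_split (a b c : L) (s : seq L) : RDP L ->
  ea_add a b = Some c -> decomposition c s ->
  exists s1 s2 : seq L,
    [/\ decomposition a s1, decomposition b s2 &
        \sum_(y <- s) ng_norm (mu y) <=
        \sum_(y <- s1) ng_norm (mu y) + \sum_(y <- s2) ng_norm (mu y)].
Proof.
case: s => [//|x s] rdp ab /(orthosum_split rdp ab).
move=> [x1 [x2 [s1 [s2 [x12 xs1 xs2 le_s]]]]].
exists (x1 :: s1), (x2 :: s2); split=> //.
by rewrite !big_cons addrACA lerD // measure_norm_le.
Qed.

Lemma le_variation (e : L) (s : seq L) : decomposition e s ->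
  ((\sum_(x <- s) ng_norm (mu x))%:E <= variation mu e)%E.
Proof. by move=> es; apply: ereal_sup_ubound; exists s. Qed.

Lemma variation_le (e : L) (C : \bar R) :
  (forall s, decomposition e s -> ((\sum_(x <- s) ng_norm (mu x))%:E <= C)%E) ->
  (variation mu e <= C)%E.
Proof. by move=> le_C; apply: ge_ereal_sup => _ [s es <-]; apply: le_C. Qed.

Lemma variation_ge0 (e : L) : (0 <= variation mu e)%E.
Proof.
(* The one-term decomposition keeps the supremum from being that of the empty set, which is -oo. *)
apply: le_trans (le_variation (erefl : decomposition e [:: e])).
by rewrite big_seq1 lee_fin ng_norm_ge0.
Qed.

Lemma variation_superadditive (a b c : L) : ea_add a b = Some c ->
  (variation mu a + variation mu b <= variation mu c)%E.
Proof.
move=> ab; have := variation_ge0 c.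
(* Only a finite value [r] needs work. The suprema over decompositions of [b] and of [a] are then
   taken one after the other, each time moving the other summand across the inequality, which
   requires it to be finite. *)
case vc: (variation mu c) => [r| |] // _; last by rewrite leey.
have le_cat s t : decomposition a s -> decomposition b t ->
    ((\sum_(x <- s) ng_norm (mu x))%:E + (\sum_(x <- t) ng_norm (mu x))%:E
      <= r%:E)%E.
  move=> sa tb; rewrite -vc -EFinD -big_cat; apply: le_variation.
  exact: decomposition_cat ab sa tb.
have le_b s : decomposition a s ->
    ((\sum_(x <- s) ng_norm (mu x))%:E + variation mu b <= r%:E)%E.
  move=> sa; rewrite addeC -leeBrDr //; apply: variation_le => t tb.
  by rewrite leeBrDr // addeC le_cat.
(* Finiteness comes from [le_b] at the one-term decomposition of [a], whose norm sum is
   nonnegative. *)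
have vb_fin : variation mu b \is a fin_num.
  rewrite ge0_fin_numE ?variation_ge0 //; apply: le_lt_trans (ltry r).
  apply: le_trans (le_b [:: a] erefl); rewrite leeDr //.
  by rewrite big_seq1 lee_fin ng_norm_ge0.
rewrite -leeBrDr //; apply: variation_le => s sa.
by rewrite leeBrDr // le_b.
Qed.

Lemma variation_subadditive (a b c : L) : RDP L -> ea_add a b = Some c ->
  (variation mu c <= variation mu a + variation mu b)%E.
Proof.
move=> rdp ab; apply: variation_le => s sc.
have [s1 [s2 [sa sb le_s]]] := decomposition_split rdp ab sc.
apply: (@le_trans _ _ (_ + _)%:E); first by rewrite lee_fin; exact: le_s.
by rewrite EFinD; apply: leeD; apply: le_variation.
Qed.

End Variation.

Theorem corollary4p4 (R : realType) (L : effectAlgebra) (G : normedGroup R)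
    (mu : L -> G) (hL : RDP L) (hmu : is_measure mu) :
  (forall e : L, (0 <= variation mu e)%E) /\
  is_measure (variation mu).
Proof.
split; first exact: variation_ge0.
move=> a b c ab; apply/eqP; rewrite eq_le; apply/andP; split.
  exact: variation_subadditive.
exact: variation_superadditive.
Qed.
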